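(* Let $G$ be a finite group and $H$ a subgroup of $G$. If either the order of $H$ is odd or the index of $H$ in $G$ is odd, then $H$ is a perfect code of $G$.
   Context: For a finite group $G$ with identity $1$ and a subset $S\subseteq G\setminus\{1\}$ with $S^{-1}=S$ (possibly $S=\emptyset$), the Cayley graph $\mathrm{Cay}(G,S)$ has vertex set $G$, with $x,y$ adjacent if and only if $yx^{-1}\in S$. A perfect code in a graph $\Gamma$ with vertex set $V$ is a subset $C\subseteq V$ such that no two vertices of $C$ are adjacent and every vertex in $V\setminus C$ is adjacent to exactly one vertex in $C$. A subset (in particular a subgroup) $C$ of $G$ is called a perfect code of $G$ if there exists such an $S$ for which $C$ is a perfect code in $\mathrm{Cay}(G,S)$. *)

(* Defs.v *)
From mathcomp Require Import all_boot all_fingroup.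

Set Implicit Arguments.
Unset Strict Implicit.
Unset Printing Implicit Defensive.

Local Open Scope group_scope.

(* The graph has vertex set V and adjacency relation e (restricted to V). *)
Definition perfect_code_graph (T : finType) (V : {set T}) (e : rel T)
    (C : {set T}) : Prop :=
  [/\ C \subset V,
      {in C &, forall x y, ~~ e x y}
    & {in V :\: C, forall v, #|[set c in C | e v c]| = 1%N}].

Definition cayley_adj (gT : finGroupType) (S : {set gT}) : rel gT :=
  fun x y => y * x^-1 \in S.

Definition connection_set (gT : finGroupType) (G S : {set gT}) : Prop :=
  S \subset G^# /\ S^-1 = S.

Definition perfect_code (gT : finGroupType) (G : {group gT})
    (C : {set gT}) : Prop :=
  exists S : {set gT},
    connection_set G S /\ perfect_code_graph G (cayley_adj S) C.

(* Main.v *)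
Require Import Defs.
From mathcomp Require Import all_boot all_fingroup all_solvable.

(** Write S for the connection set together with 1.  Then H is a perfect code
    in the Cayley graph exactly when S meets every right coset of H in G once,
    so the task is to find a transversal of the right cosets that is closed
    under inversion.

    Take a maximal inverse-closed set S containing 1 whose elements lie in
    distinct right cosets of H, and suppose that some coset H x is missed.  By
    maximality no pair t, t^-1 can be added to S ([maxset_extension]).  Let
    D = H x H.  A right coset H y in D^-1 always contains the inverse of some
    element of H x ([rcoset_inv_meet]), so H x is the only coset in D^-1 that S
    can miss; and it does miss one, because D and D^-1 contain equally many
    right cosets and equally many elements of S.  Hence D = D^-1, and S meets
    all but one of the n right cosets in D.

    If some t in D had t^2 = 1, then a conjugate of t by an element of H would
    lie in H x ([rcoset_involution]) and could be added to S.  So inversion has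
    no fixed point on D, the number n - 1 of elements of S in D is even
    ([even_inv_closed]), and n is odd.  The oddness hypotheses exclude this
    ([double_coset_involution]): since D = D^-1, we may choose x with x^2 in H;
    if #|H| is odd, then x ^+ #|H| is an element of H x that squares to 1; if
    #|G : H| is odd, then K = H :&: H :^ x has odd index #|G : H| * n in G and
    is normalised by x, so x, which squares into K, lies in K, and 1 is in D. *)

Set Implicit Arguments.
Unset Strict Implicit.
Unset Printing Implicit Defensive.

Import GroupScope.

Section InverseClosedTransversal.

Variable gT : finGroupType.
Implicit Types (G H : {group gT}) (A S : {set gT}) (x y t : gT).

(** * Double cosets and elements that square to 1 *)

Lemma mem_invset_closed A x : A^-1 = A -> (x^-1 \in A) = (x \in A).
Proof. by move=> {1}<-; rewrite mem_invg invgK. Qed.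

(** Inversion splits [A] into pairs; ranking the elements selects one of each
    pair. *)
Lemma even_inv_closed A :
  A^-1 = A -> {in A, forall t, t * t != 1} -> ~~ odd #|A|.
Proof.
move=> invA nofix.
pose B := [set t in A | enum_rank t < enum_rank t^-1].
have sBA : B \subset A by apply/subsetP => t; rewrite inE => /andP[].
have defC : A :\: B = B^-1.
  apply/setP=> t; rewrite !inE invgK mem_invset_closed //.
  have [tA|] := boolP (t \in A); rewrite ?andbF //= andbT -leqNgt leq_eqVlt.
  case: eqP => //= /val_inj /enum_rank_inj tV.
  by have := nofix t tA; rewrite -{1}tV mulVg eqxx.
by rewrite -(cardsID B A) (setIidPr sBA) defC card_invg addnn odd_double.
Qed.

Lemma mem_double_coset H x y :
  reflect (exists h k, [/\ h \in H, k \in H & y = h * x * k])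
          (y \in H :* x * H).
Proof.
apply: (iffP mulsgP) => [[z k /rcosetP[h hH ->] kH ->]|[h [k [hH kH ->]]]].
  by exists h, k.
by exists (h * x) k; rewrite ?mem_rcoset ?mulgK.
Qed.

Lemma invg_double_coset H x : (H :* x * H)^-1 = H :* x^-1 * H.
Proof. by rewrite !invMg invGid invg_set1 mulgA. Qed.

Lemma eq_double_coset H x y :
  y \in H :* x * H -> H :* x * H = H :* y * H.
Proof.
move=> /mem_double_coset[h [k [hH kH ->]]].
by rewrite !rcosetM (rcoset_id hH) -[RHS]mulgA (lcoset_id kH).
Qed.

Lemma rcoset_inv_meet H x y :
  y \in (H :* x * H)^-1 -> exists2 t, t \in H :* x & t^-1 \in H :* y.
Proof.
rewrite invg_double_coset => /mem_double_coset[h [k [hH kH ->]]].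
exists (k^-1 * x); first by rewrite mem_rcoset mulgK groupV.
by rewrite mem_rcoset !invMg !invgK !mulgA mulgK mulVg mul1g groupV.
Qed.

(** The right cosets in [H t H] are the [H t h] for [h] in [H], and [H t h]
    contains the conjugate [t ^ h]. *)
Lemma rcoset_involution H x t :
  t \in H :* x * H -> t * t = 1 -> exists2 u, u \in H :* x & u * u = 1.
Proof.
move=> /mem_double_coset[h [k [hH kH deft]]] tt1.
exists (t ^ k^-1); last by rewrite -conjMg tt1 conj1g.
by rewrite mem_rcoset conjgE invgK deft !mulgA !mulgK groupM.
Qed.

(** The witness is [x ^+ #|H|].  It lies in [H x] because [#|H|.-1] is even and
    [x ^+ 2] is in [H], and it squares to [(x ^+ 2) ^+ #|H| = 1]. *)
Lemma rcoset_involution_odd H x :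
  odd #|H| -> x * x \in H -> exists2 t, t \in H :* x & t * t = 1.
Proof.
move=> oddH xxH; exists (x ^+ #|H|).
  have defH : #|H| = (#|H|./2.*2).+1.
    by rewrite -[LHS]odd_double_half oddH.
  by rewrite defH mem_rcoset expgSr mulgK -mul2n expgM groupX // expgS expg1.
have cxx : commute x x by [].
by rewrite -expgMn // (expg_cardG xxH).
Qed.

(** The number [n] of right cosets in [H x H] is the index in [H] of
    [K := H :&: H :^ x], so [#|G : K|] is odd.  As [x ^+ 2] is in [H],
    conjugation by [x] swaps [H] and [H :^ x] and normalises [K]; the image of
    [x] in ['N_G(K) / K], a group of odd order, squares to 1 and so is 1. *)
Lemma mem_sqr_odd_index G H x n :
    H \subset G -> x \in G -> x * x \in H -> odd #|G : H| ->
  #|H :* x * H| = (#|H| * n)%N -> odd n -> x \in H.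
Proof.
move=> sHG xG xxH oddGH cardD oddn; pose K := (H :&: H :^ x)%G.
have xxHx : (H :^ x) :^ x = H :> {set gT}.
  by rewrite -conjsgM conjGid.
have nKx : x \in 'N(K).
  by apply/normP; rewrite /= conjIg xxHx setIC.
have sKH : K \subset H by apply: subsetIl.
have sKG : K \subset G := subset_trans sKH sHG.
have indexK : #|H : K| = n.
  have cardHxH : #|H :^ x * H| = (#|H| * n)%N.
    rewrite -cardD -(card_lcoset (H :^ x * H) x); congr #|pred_of_set _|.
    by rewrite mulgA conjsgE lcosetKV.
  have := mul_cardG (H :^ x) H.
  rewrite cardHxH cardJg -mulnA => /eqP; rewrite eqn_pmul2l ?cardG_gt0 //.
  rewrite setIC -(Lagrange sKH) mulnC eqn_pmul2r ?cardG_gt0 //.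
  by move=> /eqP.
have oddGK : odd #|G : K|.
  by rewrite -(Lagrange_index sHG sKH) oddM oddGH indexK.
have xNK : x \in 'N_G(K) by rewrite inE xG.
have oddNK : odd #|'N_G(K) / K|.
  rewrite card_quotient ?subsetIr //.
  have := oddGK; rewrite -(@Lagrange_index _ G 'N_G(K) K) ?subsetIl //.
    by rewrite oddM => /andP[].
  by rewrite subsetI sKG normG.
have xxK : x * x \in K.
  by rewrite inE xxH mem_conjg conjgE invgK !mulgA mulgK.
have ord2 : #[coset K x] %| 2.
  by rewrite order_dvdn expgS expg1 -morphM //= coset_id.
have ordodd : odd #[coset K x].
  by apply: dvdn_odd oddNK; apply/order_dvdG/mem_quotient.
have cx1 : coset K x = 1.
  apply/eqP; rewrite -order_eq1.
  by move: ord2 ordodd; rewrite dvdn_divisors // !inE => /orP[] /eqP->.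
by apply: (subsetP sKH); apply/(coset_idr nKx).
Qed.

Lemma double_coset_involution G H x n :
    H \subset G -> odd #|H| \/ odd #|G : H| ->
    x \in G -> x \in (H :* x * H)^-1 ->
    #|H :* x * H| = (#|H| * n)%N -> odd n ->
  exists2 t, t \in H :* x * H & t * t = 1.
Proof.
move=> sHG oddHG xG xDV cardD oddn.
have [y yHx yVHx] := rcoset_inv_meet xDV.
have defHx := rcoset_eqP yHx.
have yyH : y * y \in H.
  by move: yVHx; rewrite -defHx mem_rcoset -invMg groupV.
move: cardD; rewrite -defHx => cardD.
have sHyD : H :* y \subset H :* y * H by apply: mulg_subl.
case: oddHG => [oddH | oddGH].
  have [t tHy tt1] := rcoset_involution_odd oddH yyH.
  by exists t => //; apply: (subsetP sHyD).
have yG : y \in G.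
  have /rcosetP[h hH ->] := yHx.
  by rewrite groupM // (subsetP sHG).
exists 1; last by rewrite mulg1.
apply: (subsetP sHyD); rewrite mem_rcoset mul1g groupV.
exact: (mem_sqr_odd_index sHG yG yyH oddGH cardD oddn).
Qed.

(** * Inverse-closed partial transversals *)

(** Encoded as a boolean because maximal sets are taken for boolean
    predicates. *)
Definition rcoset_separated H S :=
  [forall s in S, forall t in S, (t * s^-1 \in H) ==> (s == t)].

Lemma rcoset_separatedP H S :
  reflect {in S &, forall s t, t * s^-1 \in H -> s = t}
          (rcoset_separated H S).
Proof.
apply: (iffP 'forall_in_forall_inP) => sep; last first.
  by move=> s sS t tS; apply/implyP => tsH; apply/eqP/sep.
by move=> s t sS tS tsH; apply/eqP/(implyP (sep s sS t tS)).
Qed.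

Lemma card_mulg_separated H S :
  rcoset_separated H S -> #|H * S| = (#|H| * #|S|)%N.
Proof.
move=> /rcoset_separatedP sepS.
rewrite [H * S]curry_imset2X card_in_imset ?cardsX //.
move=> [h s] [k t]; rewrite !inE /= => /andP[hH sS] /andP[kH tS] eq_hs.
have eq_st : s = t.
  apply: sepS => //; have -> : t = k^-1 * (h * s) by rewrite eq_hs mulKg.
  by rewrite mulgA mulgK groupM ?groupV.
by move: eq_hs; rewrite eq_st => /mulIg->.
Qed.

Definition inv_partial_transversal G H S :=
  [&& S \subset G, S^-1 == S & rcoset_separated H S].

Lemma rcoset_separatedU H A S :
    rcoset_separated H A -> rcoset_separated H S -> [disjoint A & H * S] ->
  rcoset_separated H (A :|: S).
Proof.
move=> /rcoset_separatedP sepA /rcoset_separatedP sepS disAS.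
have notin a s : a \in A -> s \in S -> a * s^-1 \notin H.
  move=> aA sS; apply: contraFN (disjointFr disAS aA) => asH.
  by rewrite -(mulgKV s a) mem_mulg.
apply/rcoset_separatedP => u v; rewrite !inE => /orP[uA|uS] /orP[vA|vS].
- exact: sepA.
- by rewrite -groupV invMg invgK => /(negP (notin u v uA vS)).
- by move=> /(negP (notin v u vA uS)).
- exact: sepS.
Qed.

Lemma rcoset_separated_pair H t :
  t * t = 1 \/ t * t \notin H -> rcoset_separated H [set t; t^-1].
Proof.
move=> ttP; apply/rcoset_separatedP => u v.
have eqtV : t * t \in H -> t = t^-1.
  case: ttP => [tt1 _|/negPf-> //].
  by apply: (mulIg t); rewrite mulVg.
rewrite !inE => /orP[]/eqP-> /orP[]/eqP-> //.
  by rewrite -invMg groupV.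
by rewrite invgK => /eqtV.
Qed.

Lemma maxset_extension G H S A :
    maxset (inv_partial_transversal G H) S -> A \subset G -> A^-1 = A ->
    rcoset_separated H A -> [disjoint A & H * S] ->
  A = set0.
Proof.
move=> /maxsetP[/and3P[sSG /eqP invS sepS] maxS] sAG invA sepA disAS.
have pAS : inv_partial_transversal G H (A :|: S).
  apply/and3P; split; first by rewrite subUset sAG.
    apply/eqP/setP=> u; rewrite mem_invg !inE.
    by rewrite !mem_invset_closed.
  exact: rcoset_separatedU.
have sAS : A \subset S by rewrite -(maxS _ pAS (subsetUr _ _)) subsetUl.
apply/eqP; rewrite -subset0 -(disjoint_setI0 disAS) subsetI subxx.
exact: subset_trans sAS (mulG_subr _ _).
Qed.

(** The disjunction makes [t] and [t^-1] either equal or representatives of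
    different right cosets of [H]. *)
Lemma maxset_meets_pair G H S t :
    maxset (inv_partial_transversal G H) S -> t \in G ->
    t * t = 1 \/ t * t \notin H -> t \notin H * S -> t^-1 \in H * S.
Proof.
move=> maxS tG ttP nt; apply: contraT => ntV.
have : t \in [set t; t^-1] by rewrite set21.
rewrite (maxset_extension maxS _ _ (rcoset_separated_pair ttP)) ?inE //.
- by rewrite subUset !sub1set groupV tG.
- by rewrite invUg !invg_set1 invgK setUC.
by apply/pred0P=> u /=; rewrite !inE; apply/andP => -[/orP[]/eqP->]; apply/negP.
Qed.

Lemma mem_mulg_rcoset H S x y :
  y \in H :* x -> (y \in H * S) = (x \in H * S).
Proof.
have absorb u v : u \in H :* v -> v \in H * S -> u \in H * S.
  case/rcosetP=> h hH -> vHS.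
  by rewrite -[H : {set gT}]mulGid -mulgA mem_mulg.
move=> yHx; apply/idP/idP; apply: absorb => //.
by rewrite rcoset_sym.
Qed.

Lemma mulg_setI_absorb H S A : H * A = A -> (H * S) :&: A = H * (S :&: A).
Proof.
move=> HA; apply/setP=> u; rewrite inE; apply/andP/idP.
  case=> /mulsgP[h s hH sS ->] hsA; apply: mem_mulg; rewrite // inE sS.
  by rewrite -HA -(mulKg h s) mem_mulg ?groupV.
case/mulsgP=> h s hH; rewrite inE => /andP[sS sA] ->.
by rewrite -HA !mem_mulg.
Qed.

(** A coset missed by a maximal [S] leads to a self-inverse double coset with
    an odd number of right cosets and no element that squares to 1. *)
Lemma maxset_covers G H S :
    H \subset G -> odd #|H| \/ odd #|G : H| ->
    maxset (inv_partial_transversal G H) S -> G \subset H * S.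
Proof.
move=> sHG oddHG maxS; apply/subsetP=> x xG; apply: contraT => nx.
have [/and3P[sSG /eqP invS sepS] _] := maxsetP maxS.
set D := H :* x * H.
have HD : H * D = D by rewrite /D !mulgA mulGid.
have HDV : H * D^-1 = D^-1 by rewrite invg_double_coset !mulgA mulGid.
have sDG : D \subset G by rewrite !mul_subG ?sub1set.
have missHx u : u \in H :* x -> u \notin H * S.
  by move=> /(mem_mulg_rcoset S)->.
have cardSD A : H * A = A -> #|(H * S) :&: A| = (#|H| * #|S :&: A|)%N.
  move=> HA; rewrite mulg_setI_absorb // card_mulg_separated //.
  move/rcoset_separatedP: sepS => sepS; apply/rcoset_separatedP => s t.
  by rewrite !inE => /andP[sS _] /andP[tS _]; apply: sepS.
have cardSDV : #|S :&: D^-1| = #|S :&: D|.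
  by rewrite -{1}invS -invIg card_invg.
have sHxD : H :* x \subset D by apply: mulg_subl.
have missDV : D^-1 :\: H * S \subset H :* x.
  apply/subsetP=> y; rewrite inE => /andP[ny yDV].
  have [t tHx tVHy] := rcoset_inv_meet yDV.
  have tG : t \in G by apply: (subsetP sDG); apply: (subsetP sHxD).
  have ntV : t^-1 \notin H * S by rewrite (mem_mulg_rcoset S tVHy).
  (* If t^2 is in H then t^-1 is in H t, so H x = H t = H t^-1 = H y. *)
  have [ttH|ttH] := boolP (t * t \in H); last first.
    by rewrite (maxset_meets_pair maxS tG (or_intror ttH) (missHx t tHx)) in ntV.
  rewrite -(rcoset_eqP tHx).
  have -> : H :* t = H :* t^-1.
    by apply/rcoset_eqP; rewrite mem_rcoset invgK.
  by rewrite (rcoset_eqP tVHy) rcoset_refl.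
have cardmiss : #|D^-1 :\: H * S| = #|D :\: H * S|.
  have := cardsID (H * S) D^-1; rewrite card_invg -(cardsID (H * S) D).
  by rewrite ![_ :&: (H * S)]setIC !cardSD // cardSDV => /addnI.
have sHxmiss : H :* x \subset D :\: H * S.
  by apply/subsetP=> u uHx; rewrite inE missHx //= (subsetP sHxD).
have defmiss : D^-1 :\: H * S = H :* x.
  by apply/eqP; rewrite eqEcard missDV cardmiss subset_leq_card.
have xDV : x \in D^-1.
  have : x \in D^-1 :\: H * S by rewrite defmiss rcoset_refl.
  by case/setDP.
have cardD : #|D| = (#|H| * #|S :&: D|.+1)%N.
  by rewrite -(cardsID (H * S) D) -cardmiss defmiss card_rcoset setIC cardSD
    // mulnS addnC.
have noinv t : t \in D -> t * t != 1.
  move=> tD; apply/eqP => /(rcoset_involution tD)[u uHx uu1].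
  have uG : u \in G by apply: (subsetP sDG); apply: (subsetP sHxD).
  have uV : u^-1 = u by apply: (mulIg u); rewrite mulVg.
  have nu := missHx u uHx.
  by have := maxset_meets_pair maxS uG (or_introl uu1) nu; rewrite uV (negPf nu).
have defDV : D^-1 = D.
  move: xDV; rewrite invg_double_coset => xDV.
  exact: eq_double_coset xDV.
have evenSD : ~~ odd #|S :&: D|.
  apply: even_inv_closed => [|t /setIP[_]]; last exact: noinv.
  by rewrite invIg invS defDV.
have [t tD tt1] := double_coset_involution sHG oddHG xG xDV cardD evenSD.
by have := noinv t tD; rewrite tt1 eqxx.
Qed.

(** * Perfect codes from inverse-closed transversals *)

Lemma transversal_perfect_code G H S :
    inv_partial_transversal G H S -> 1 \in S -> H \subset G ->
    G \subset H * S -> perfect_code G H.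
Proof.
move=> /and3P[sSG /eqP invS /rcoset_separatedP sepS] S1 sHG covS.
exists (S :\ 1); split; first split.
- exact: setSD.
- by apply/setP=> u; rewrite mem_invg !inE mem_invset_closed // eq_invg1.
split=> // [u v uH vH|v /setDP[vG nvH]].
  rewrite /cayley_adj !inE negb_and negbK; apply/orP.
  have [vuS|] := boolP (v * u^-1 \in S); last by right.
  by left; rewrite (sepS 1 (v * u^-1)) // invg1 mulg1 groupM ?groupV.
have /mulsgP[h s hH sS defvV] : v^-1 \in H * S.
  by rewrite (subsetP covS) ?groupV.
(* A neighbour c of v in H satisfies c * v^-1 = (c * h) * s with both c * v^-1
   and s in S, so c * h = 1. *)
apply/eqP/cards1P; exists h^-1; apply/setP=> c.
rewrite !inE /cayley_adj !inE defvV; apply/andP/eqP => [[cH /andP[_ chsS]]|->].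
  have := sepS s _ sS chsS; rewrite !mulgA mulgK groupM // => /(_ isT) eqs.
  by apply: (mulIg h); rewrite mulVg; apply: (mulIg s); rewrite mul1g.
rewrite mulKg groupV sS andbT; split=> //.
by apply: contra nvH => /eqP s1; rewrite -groupV defvV s1 mulg1.
Qed.

End InverseClosedTransversal.

Theorem theorem3p5 (gT : finGroupType) (G H : {group gT}) (sHG : H \subset G)
    (oddHG : odd #|H| \/ odd #|G : H|%g) : perfect_code G H.
Proof.
have p1 : inv_partial_transversal G H [set 1].
  apply/and3P; split; [by rewrite sub1set | by rewrite invg_set1 invg1 |].
  by apply/rcoset_separatedP => s t /set1P-> /set1P->.
have [S maxS s1S] := maxset_exists p1.
apply: (transversal_perfect_code (maxsetp maxS)) => //.
  by rewrite sub1set in s1S.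
exact: maxset_covers maxS.
Qed.
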